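(* Fix $\eta\in(0,1)$. There is a constant $C$ depending only on $\eta$ such that for all integers $1\le k\le n$ and every stochastic blockmodel on $n$ vertices with $k$ blocks, the USVT estimator $\hat M$ with tuning parameter $\eta$ of the edge-probability matrix $M$, computed from the fully observed adjacency matrix $X$, satisfies $$\operatorname{MSE}(\hat M)\le C\sqrt{\frac kn}.$$
   Context: Stochastic blockmodel with $k$ blocks: the vertices $1,\dots,n$ of an undirected random graph are partitioned into $k$ blocks; $M=(m_{ij})$ is the symmetric $n\times n$ matrix whose entry $m_{ij}\in[0,1]$ is the probability of an edge between $i$ and $j$, and $m_{ij}$ depends only on the blocks to which $i$ and $j$ belong (for all $i,j$, including $i=j$). Edges are independent: the adjacency matrix $X$ is a symmetric random matrix with $\{0,1\}$-valued entries, independent on and above the diagonal, with $\mathbb{E}(x_{ij})=m_{ij}$. All entries of $X$ are observed. $\operatorname{MSE}(\hat M):=\mathbb{E}\big[\frac1{n^2}\sum_{i,j=1}^n(\hat m_{ij}-m_{ij})^2\big]$. USVT estimator with tuning parameter $\eta\in(0,1)$ (fully observed case): let $X=\sum_{i=1}^n s_iu_iv_i^T$ be the singular value decomposition of $X$, $S:=\{i:s_i\ge(2+\eta)\sqrt n\}$, $W:=\sum_{i\in S}s_iu_iv_i^T$, and let $\hat m_{ij}$ be the truncation of $w_{ij}$ to $[-1,1]$ ($\hat m_{ij}=w_{ij}$ if $|w_{ij}|\le1$, $1$ if $w_{ij}>1$, $-1$ if $w_{ij}<-1$). *)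

(* Defs.v *)
From HB Require Import structures.
From mathcomp Require Import all_boot all_order all_algebra.
From mathcomp Require Import all_classical all_reals all_analysis.

Set Implicit Arguments.
Unset Strict Implicit.
Unset Printing Implicit Defensive.

Import Order.TTheory GRing.Theory Num.Theory.
Import numFieldNormedType.Exports.

Local Open Scope classical_set_scope.
Local Open Scope ring_scope.

(* The columns of U and V are the left and right singular vectors. The singular
   values need not be sorted, which does not affect usvt_estimate below. *)
Definition is_svd (R : realType) (n : nat) (A : 'M[R]_n)
    (s : 'I_n -> R) (U V : 'M[R]_n) : Prop :=
  [/\ U^T *m U = 1%:M,
      V^T *m V = 1%:M,
      forall i, 0 <= s i &
      A = \sum_(i < n) s i *: (col i U *m (col i V)^T)].

Definition trunc1 (R : realType) (w : R) : R :=
  if `|w| <= 1 then w else if 1 < w then 1 else -1.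

(* The singular value decomposition is not unique, but the thresholded sum does
   not depend on the choice of one, so this relation is functional in A. *)
Definition usvt_estimate (R : realType) (eta : R) (n : nat)
    (A Mhat : 'M[R]_n) : Prop :=
  exists (s : 'I_n -> R) (U V : 'M[R]_n),
    is_svd A s U V /\
    Mhat = map_mx (@trunc1 R)
      (\sum_(i < n | (2 + eta) * Num.sqrt n%:R <= s i)
         s i *: (col i U *m (col i V)^T)).

(* Blocks are nonempty, being the cells of a partition of the vertex set. *)
Definition blockmodel (R : realType) (n k : nat) (M : 'M[R]_n) : Prop :=
  [/\ forall i j, M i j = M j i,
      forall i j, 0 <= M i j <= 1 &
      exists B : {set {set 'I_n}},
        [/\ finset.partition B [set: 'I_n]%SET,
            #|B| = k &
            forall i i' j j', finset.pblock B i = finset.pblock B i' ->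
              finset.pblock B j = finset.pblock B j' -> M i j = M i' j']].

Definition independent_RVs d (T : measurableType d) (R : realType)
    (P : probability T R) (I : finType) (D : {set I})
    (X : I -> {RV P >-> R}) : Prop :=
  forall (J : {set I}) (A : I -> set R), J \subset D ->
    (forall i, measurable (A i)) ->
    (P (\bigcap_(i in [set` J]) (X i @^-1` A i)) =
     \prod_(i in J) P (X i @^-1` A i))%E.

Definition adjacency_RVs d (T : measurableType d) (R : realType)
    (P : probability T R) (n : nat) (M : 'M[R]_n)
    (X : 'I_n -> 'I_n -> {RV P >-> R}) : Prop :=
  [/\ forall i j w, X i j w = X j i w,
      forall i j w, X i j w = 0 \/ X i j w = 1,
      independent_RVs [set ij : 'I_n * 'I_n | (ij.1 <= ij.2)%N]%SET
        (fun ij => X ij.1 ij.2) &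
      forall i j, ('E_P[X i j] = (M i j)%:E)%E].

Definition MSE d (T : measurableType d) (R : realType) (P : probability T R)
    (n : nat) (Mhat : T -> 'M[R]_n) (M : 'M[R]_n) : \bar R :=
  ('E_P[(fun w => (n%:R ^+ 2)^-1 *
                  \sum_(i < n) \sum_(j < n) (Mhat w i j - M i j) ^+ 2)%R])%E.

(* Main.v *)
(* Let Z = X - M be the noise. Deterministically, if the operator norm of Z is at
   most tau < t, where t is the threshold, let Q be the orthogonal projection on
   the k-dimensional space of blockwise constant vectors. Since M (1 - Q) = 0,
   the error splits into (W - M) Q, which has rank at most k and operator norm at
   most t + tau, and W (1 - Q), a projection of Z (1 - Q) whose rank is the number
   of retained singular values, again O(k). So the squared Frobenius error is
   O(k n) when tau = 2 sqrt n and t = (2 + eta) sqrt n.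

   That the norm of Z exceeds 2 sqrt n only with exponentially small probability,
   with the sharp constant 2 and for every n, comes from Hoeffding's lemma and a
   union bound over integer vectors: every x with |x|^2 = 4 n can be rounded
   coordinate by coordinate to an integer vector z of l1-norm at most 3 n almost
   without decreasing the quadratic form of Z, there are at most (512 / 27)^n
   such z, and each satisfies z^T Z z > a sqrt n |z|^2 with probability at most
   exp(- a^2 n), where a = 9 / 5. *)

Require Import Defs.
From HB Require Import structures.
From mathcomp Require Import all_boot all_order all_algebra.
From mathcomp Require Import all_classical all_reals all_analysis.
From mathcomp Require Import ring lra.

Set Implicit Arguments.
Unset Strict Implicit.
Unset Printing Implicit Defensive.

Import Order.TTheory GRing.Theory Num.Theory.
Import numFieldNormedType.Exports.

Local Open Scope classical_set_scope.
Local Open Scope ring_scope.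

(** * Hoeffding's lemma for Bernoulli variables *)

Lemma le0_derive_le0 (R : realType) (f df : R -> R) :
  (forall x : R, is_derive x 1 f (df x)) -> (forall x : R, 0 <= x -> df x <= 0) ->
  forall x : R, 0 <= x -> f x <= f 0.
Proof.
move=> fd df0 x x0.
apply: (@ler0_derive1_nincry R f 0) => //.
- move=> y; rewrite in_itv/= andbT => /ltW y0.
  by rewrite derive1E (@derive_val _ _ _ _ _ _ _ (fd y)) df0.
- apply: continuous_subspaceT => y.
  by apply: differentiable_continuous; apply/derivable1_diffP; case: (fd y).
Qed.

(* This is [tanh (y / 2) <= y / 2]. *)
Lemma expR_sub1_le (R : realType) (y : R) : 0 <= y ->
  expR y - 1 <= y / 2 * (expR y + 1).
Proof.
move=> y0.
have := @le0_derive_le0 R (fun y => expR y - 1 - y / 2 * (expR y + 1))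
  (fun y => expR y - (1 / 2 * (expR y + 1) + y / 2 * expR y)).
rewrite expR0 mul0r mul0r subrr subr0 => h.
suff /h{}h : forall x : R, is_derive x 1
    (fun y => expR y - 1 - y / 2 * (expR y + 1))
    (expR x - (1 / 2 * (expR x + 1) + x / 2 * expR x)).
  rewrite -subr_le0; apply: (h _ y y0) => x x0.
  have e0 := expR_gt0 x.
  (* The derivative is half of [(1 - x) * expR x - 1]. *)
  have : (1 - x) * expR x <= 1.
    rewrite -[leRHS](expRxMexpNx_1 x) mulrC ler_pM2l//.
    by have := expR_ge1Dx (- x).
  lra.
move=> x; apply: is_derive_eq.
rewrite /GRing.scale/=; ring.
Qed.

(* For fixed E the left-hand side over the right-hand denominator is maximal
   where p E = 1 - p. *)
Lemma bernoulli_tilt_le (R : realType) (p E : R) : 0 <= p <= 1 -> 1 <= E ->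
  p * (1 - p) * (E ^+ 2 - 1) * (E + 1) <= (E - 1) * (1 - p + p * E ^+ 2).
Proof.
move=> p01 E1.
have : 0 <= (E - 1) * (1 - p - p * E) ^+ 2.
  by rewrite mulr_ge0 ?sqr_ge0 ?subr_ge0.
rewrite -subr_ge0 => h; rewrite -subr_ge0; apply: le_trans h _.
rewrite le_eqVlt; apply/orP; left; apply/eqP; ring.
Qed.

(** The quotient [f] of the two sides is 1 at 0 and nonincreasing. With [E = expR (h / 2)] and
    [D = 1 - p + p * E ^+ 2], the sign of its derivative amounts to
    [p * (1 - p) * (E ^+ 2 - 1) <= h / 4 * D]. The left side is at most [D * (E - 1) / (E + 1)] by
    [bernoulli_tilt_le], and [expR_sub1_le] at [h / 2] bounds the last quotient by [h / 4]. *)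
Lemma bernoulli_mgf_ge0 (R : realType) (p h : R) : 0 <= p <= 1 -> 0 <= h ->
  1 - p + p * expR h <= expR (p * h + h ^+ 2 / 8).
Proof.
move=> p01 h0.
set f := fun h : R => (1 - p + p * expR h) * expR (- (p * h + h ^+ 2 / 8)).
suff /(_ h h0) : forall h, 0 <= h -> f h <= f 0.
  rewrite /f expR0 mulr0 expr0n/= mul0r addr0 oppr0 expR0 !mulr1 subrK.
  by rewrite expRN ler_pdivrMr ?expR_gt0// mul1r.
apply: (@le0_derive_le0 R f (fun h => (p * expR h -
  (p + h / 4) * (1 - p + p * expR h)) * expR (- (p * h + h ^+ 2 / 8)))).
  by move=> x; rewrite /f; apply: is_derive_eq; rewrite /GRing.scale/=; field.
move=> {}h {}h0; rewrite mulr_le0_ge0 ?expR_ge0// subr_le0.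
have E1 : 1 <= expR (h / 2) by rewrite -expR0 ler_expR divr_ge0.
have -> : expR h = expR (h / 2) ^+ 2.
  by rewrite -expRM_natl; congr expR; field.
have h20 : 0 <= h / 2 by rewrite divr_ge0.
have := expR_sub1_le h20; have := bernoulli_tilt_le p01 E1.
set E := expR (h / 2) in E1 *; set D := 1 - p + p * E ^+ 2 => h1 h2.
have D0 : 0 <= D by rewrite addr_ge0 ?mulr_ge0 ?sqr_ge0//; lra.
rewrite -(@ler_pM2r _ (E + 1)); last lra.
have h3 := ler_wpM2r D0 h2.
have {}h3 := le_trans h1 h3.
have -> : p * E ^+ 2 = p * D + p * (1 - p) * (E ^+ 2 - 1) by rewrite /D; ring.
have -> : (p + h / 4) * D * (E + 1) = p * D * (E + 1) + h / 2 / 2 * (E + 1) * D by field.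
by rewrite mulrDl lerD2l.
Qed.

(** Negative [h] is reduced to the previous case by exchanging the outcomes 0 and 1, that is, by
    passing to [1 - p] and [- h]. *)
Lemma bernoulli_mgf (R : realType) (p h : R) : 0 <= p <= 1 ->
  1 - p + p * expR h <= expR (p * h + h ^+ 2 / 8).
Proof.
move=> p01; have [h0|h0] := leP 0 h; first exact: bernoulli_mgf_ge0.
have q01 : 0 <= 1 - p <= 1 by lra.
have h0' : 0 <= - h by lra.
have := ler_wpM2r (expR_ge0 h) (bernoulli_mgf_ge0 q01 h0').
rewrite -expRD sqrrN.
have -> : (1 - p) * - h + h ^+ 2 / 8 + h = p * h + h ^+ 2 / 8 by ring.
apply: le_trans; rewrite mulrDl -mulrA [expR (- h) * _]mulrC expRxMexpNx_1.
by rewrite subKr mulr1 addrC.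
Qed.

(** * Products and exponentials of independent 0-1 variables *)

Lemma integrable_lincomb d (T : measurableType d) (R : realType)
    (P : probability T R) (I : finType) (c : I -> R) (Y : I -> T -> R) :
  (forall i, P.-integrable setT (EFin \o Y i)) ->
  P.-integrable setT (EFin \o (fun w => \sum_i c i * Y i w)).
Proof.
move=> iY.
rewrite [X in P.-integrable _ X](_ : _ =
    (fun w => \sum_i (c i)%:E * (EFin \o Y i) w)%E); last first.
  by apply/funext => w /=; rewrite -sumEFin; apply: eq_bigr => i _; rewrite EFinM.
by apply: integrable_sum => // i _; apply: integrableZl.
Qed.

Lemma expectation_lincomb d (T : measurableType d) (R : realType)
    (P : probability T R) (I : finType) (c : I -> R) (Y : I -> T -> R) :
  (forall i, P.-integrable setT (EFin \o Y i)) ->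
  ('E_P[(fun w => \sum_i c i * Y i w)%R] = \sum_i (c i)%:E * 'E_P[Y i])%E.
Proof.
move=> iY; rewrite unlock.
under eq_integral do rewrite -sumEFin.
rewrite integral_sum//; last first.
  by move=> i; under eq_fun do rewrite EFinM; apply: integrableZl => //; apply: iY.
apply: eq_bigr => i _; under eq_integral do rewrite EFinM.
by rewrite integralZl//; apply: iY.
Qed.

Lemma prod_01_indic d (T : measurableType d) (R : realType)
    (P : probability T R) (I : finType) (J : {set I}) (X : I -> {RV P >-> R}) :
  (forall i w, X i w = 0 \/ X i w = 1) ->
  (fun w => \prod_(i in J) X i w) =
  \1_(\bigcap_(i in [set` J]) (X i @^-1` [set 1])).
Proof.
move=> X01; apply/funext => w; rewrite indicE.
case: (boolP (w \in _)) => [/set_mem h|/negP h] /=.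
  by rewrite big1// => i iJ; apply: h.
suff /existsP[i /andP[iJ /eqP Xi0]] : [exists i, (i \in J) && (X i w == 0)].
  by rewrite (bigD1 i)//= Xi0 mul0r.
rewrite -[X in is_true X]negbK negb_exists; apply/negP => /forallP h'.
apply: h; apply/mem_set => i /= iJ; have [Xi0|//] := X01 i w.
by have := h' i; rewrite iJ Xi0 eqxx.
Qed.

Section independent_01.
Context d (T : measurableType d) (R : realType) (P : probability T R).
Variables (I : finType) (D : {set I}) (X : I -> {RV P >-> R}) (p : I -> R).
Hypotheses (X01 : forall i w, X i w = 0 \/ X i w = 1)
  (indX : independent_RVs D X) (EX : forall i, ('E_P[X i] = (p i)%:E)%E).

Let mX1 i : measurable (X i @^-1` [set 1]).
Proof. by rewrite -[_ @^-1` _]setTI; exact: measurable_funP. Qed.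

Let mcap (J : {set I}) :
  measurable (\bigcap_(i in [set` J]) (X i @^-1` [set 1])).
Proof. by apply: fin_bigcap_measurable => // i _; exact: mX1. Qed.

Lemma integrable_prod_01 (J : {set I}) :
  P.-integrable setT (EFin \o (fun w => \prod_(i in J) X i w)).
Proof. by rewrite prod_01_indic//; exact: integrable_indic. Qed.

Lemma expectation_prod_01 (J : {set I}) : J \subset D ->
  ('E_P[(fun w => \prod_(i in J) X i w)%R] = (\prod_(i in J) p i)%:E)%E.
Proof.
move=> JD; rewrite prod_01_indic// expectation_indic// indX//.
rewrite -prodEFin; apply: eq_bigr => i _.
rewrite -EX -expectation_indic//; congr expectation; apply/funext => w.
rewrite indicE; case: (boolP (w \in _)) => [/set_mem ->//|/negP Xi1].
by case: (X01 i w) => // Xi; case: Xi1; apply/mem_set.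
Qed.

(** Independence is stated for events. This expansion reduces products of affine functions of the
    [X i] to products of the [X i] themselves, which are indicators of events. *)
Let prod_expand (a b : I -> R) (f : I -> R) :
  \prod_(i in D) (a i + b i * f i) =
  \sum_(J : {set I}) (if J \subset D then
    \prod_(i in J) b i * \prod_(i in D :\: J) a i else 0) * \prod_(i in J) f i.
Proof.
rewrite big_mkcond/=.
(* The summands 0 and 1 outside [D] extend the product to all of [I] and kill every subset not
   contained in [D]. *)
transitivity (\prod_i ((if i \in D then b i * f i else 0) +
                       (if i \in D then a i else 1))).
  by apply: eq_bigr => i _; case: ifP; rewrite ?add0r// addrC.
rewrite bigA_distr; apply: eq_big => J; rewrite ?inE// => _.
case: ifPn => JD; last first.
  have [i iJ iD] := fintype.subsetPn JD.
  by rewrite (bigD1 i)//= iJ (negbTE iD) !mul0r.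
rewrite mulrAC -big_split/= [X in X * _]big_mkcond/= [X in _ * X]big_mkcond/=.
rewrite -big_split/=; apply: eq_bigr => i _; rewrite inE.
case: ifPn => iJ /=; first by rewrite (fintype.subsetP JD) ?mulr1.
by rewrite mul1r.
Qed.

Lemma integrable_prod_affine_01 (a b : I -> R) :
  P.-integrable setT (EFin \o (fun w => \prod_(i in D) (a i + b i * X i w))).
Proof.
rewrite (_ : (fun w => _) = fun w => \sum_(J : {set I}) (if J \subset D then
    \prod_(i in J) b i * \prod_(i in D :\: J) a i else 0) * \prod_(i in J) X i w).
  by apply: integrable_lincomb => J; exact: integrable_prod_01.
by apply/funext => w; rewrite prod_expand.
Qed.

Lemma expectation_prod_affine_01 (a b : I -> R) :
  ('E_P[(fun w => \prod_(i in D) (a i + b i * X i w))%R] =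
   (\prod_(i in D) (a i + b i * p i))%:E)%E.
Proof.
rewrite (_ : (fun w => _) = fun w => \sum_(J : {set I}) (if J \subset D then
    \prod_(i in J) b i * \prod_(i in D :\: J) a i else 0) * \prod_(i in J) X i w);
  last by apply/funext => w; rewrite prod_expand.
rewrite expectation_lincomb; last by move=> J; exact: integrable_prod_01.
rewrite prod_expand -sumEFin; apply: eq_bigr => J _.
by case: ifPn => JD; rewrite ?mul0r ?mul0e// expectation_prod_01.
Qed.

(** Every function on {0, 1} is affine, so the exponential of the sum is a product of affine
    functions. *)
Let expR_affine_01 (c : I -> R) w :
  expR (\sum_(i in D) c i * (X i w - p i)) =
  \prod_(i in D) (expR (- (c i * p i)) +
                  expR (- (c i * p i)) * (expR (c i) - 1) * X i w).
Proof.
rewrite expR_sum; apply: eq_bigr => i _; rewrite mulrBr addrC expRD.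
case: (X01 i w) => ->; first by rewrite !mulr0 expR0 mulr1 addr0.
by rewrite !mulr1; ring.
Qed.

Lemma integrable_expR_01 (c : I -> R) :
  P.-integrable setT
    (EFin \o (fun w => expR (\sum_(i in D) c i * (X i w - p i)))).
Proof.
under eq_fun do rewrite /= expR_affine_01.
exact: integrable_prod_affine_01.
Qed.

(** The factor of index [i] has mean [expR (- (c i * p i)) * (1 - p i + p i * expR (c i))], to which
    [bernoulli_mgf] applies. *)
Lemma expectation_expR_01_le (c : I -> R) : (forall i, 0 <= p i <= 1) ->
  ('E_P[(fun w => expR (\sum_(i in D) c i * (X i w - p i)))%R] <=
   (expR (\sum_(i in D) c i ^+ 2 / 8))%:E)%E.
Proof.
move=> p01; under eq_fun do rewrite expR_affine_01.
rewrite expectation_prod_affine_01 lee_fin expR_sum; apply: ler_prod => i _.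
rewrite -mulrA -[X in X + _]mulr1 -mulrDr.
have -> : 1 + (expR (c i) - 1) * p i = 1 - p i + p i * expR (c i) by ring.
have h := bernoulli_mgf (c i) (p01 i).
have e0 : 0 <= expR (- (c i * p i)) by exact: expR_ge0.
have h0 : 0 <= 1 - p i + p i * expR (c i).
  by rewrite addr_ge0 ?mulr_ge0 ?expR_ge0//; have := p01 i; lra.
rewrite mulr_ge0//=; apply: le_trans (ler_wpM2l e0 h) _.
by rewrite -expRD ler_expR; rewrite le_eqVlt; apply/orP; left; apply/eqP; ring.
Qed.

End independent_01.

(** * Quadratic forms of the noise matrix *)

Definition qform (R : realType) n (A : 'M[R]_n) (y : 'I_n -> R) : R :=
  \sum_i \sum_j y i * y j * A i j.

Definition nsq (R : realType) n (y : 'I_n -> R) : R := \sum_i y i ^+ 2.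

Lemma nsq_ge0 (R : realType) n (y : 'I_n -> R) : 0 <= nsq y.
Proof. by apply: sumr_ge0 => i _; exact: sqr_ge0. Qed.

(** Only the entries on and above the diagonal are independent, so quadratic forms have to be folded
    onto these pairs. *)
Lemma sum_sym_le_pairs (R : realType) n (f : 'I_n -> 'I_n -> R) :
  (forall i j, f i j = f j i) ->
  \sum_i \sum_j f i j =
  \sum_(ij in [set ij : 'I_n * 'I_n | (ij.1 <= ij.2)%N]%SET)
    (if ij.1 == ij.2 then 1 else 2) * f ij.1 ij.2.
Proof.
move=> fC; rewrite pair_bigA/=.
have swap_inj : injective (fun ij : 'I_n * 'I_n => (ij.2, ij.1)).
  by move=> [a b] [a' b'] /= [= -> ->].
rewrite (bigID (fun ij : 'I_n * 'I_n => (ij.1 <= ij.2)%N))/=.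
rewrite [X in _ + X](reindex_inj swap_inj)/=.
rewrite [X in _ + X](eq_bigl (fun ij : 'I_n * 'I_n =>
    ((ij.1 <= ij.2)%N && (ij.1 != ij.2)))); last first.
  by move=> [i j] /=; rewrite -ltnNge ltn_neqAle andbC.
rewrite big_mkcondr/= -big_split/=; apply: eq_big => [[i j]|[i j] _]/=.
  by rewrite inE.
case: (i =P j) => [->|_] /=; rewrite ?addr0 ?mul1r// fC; ring.
Qed.

Section adjacency_tail.
Context d (T : measurableType d) (R : realType) (P : probability T R) (n : nat).
Variables (M : 'M[R]_n) (X : 'I_n -> 'I_n -> {RV P >-> R}).
Hypotheses (adjX : adjacency_RVs M X) (M01 : forall i j, 0 <= M i j <= 1).

Let D := [set ij : 'I_n * 'I_n | (ij.1 <= ij.2)%N]%SET.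

Lemma adjacency_mean_sym i j : M i j = M j i.
Proof.
have [Xs _ _ EX] := adjX; apply: EFin_inj; rewrite -!EX.
by congr expectation; apply/funext => w; rewrite Xs.
Qed.

Let coef (s : R) (y : 'I_n -> R) (ij : 'I_n * 'I_n) : R :=
  s * ((if ij.1 == ij.2 then 1 else 2) * (y ij.1 * y ij.2)).

Let qformE (s : R) (y : 'I_n -> R) w :
  s * qform (\matrix_(i, j) X i j w - M) y =
  \sum_(ij in D) coef s y ij * (X ij.1 ij.2 w - M ij.1 ij.2).
Proof.
rewrite /qform sum_sym_le_pairs => [|i j].
  rewrite mulr_sumr; apply: eq_bigr => ij _; rewrite !mxE /coef.
  by rewrite !mulrA.
have [Xs _ _ _] := adjX.
by rewrite !mxE Xs adjacency_mean_sym [y i * _]mulrC.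
Qed.

(** Off the diagonal there is equality: the squared factor 2 over 8 against the weight 2 over 4. On
    the diagonal, 1 / 8 is compared with 1 / 4. *)
Let sum_coef_sqr (s : R) (y : 'I_n -> R) :
  \sum_(ij in D) coef s y ij ^+ 2 / 8 <= s ^+ 2 * nsq y ^+ 2 / 4.
Proof.
have -> : nsq y ^+ 2 = \sum_i \sum_j y i ^+ 2 * y j ^+ 2.
  rewrite expr2 {1}/nsq mulr_suml; apply: eq_bigr => i _.
  by rewrite /nsq mulr_sumr.
rewrite sum_sym_le_pairs => [|i j]; last by rewrite mulrC.
rewrite mulrAC mulr_sumr; apply: ler_sum => ij _; rewrite /coef !exprMn.
have := mulr_ge0 (sqr_ge0 s) (mulr_ge0 (sqr_ge0 (y ij.1)) (sqr_ge0 (y ij.2))).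
by case: ifP => _; nra.
Qed.

Lemma integrable_expR_qform (s c : R) (y : 'I_n -> R) :
  P.-integrable setT (EFin \o
    (fun w => expR (s * qform (\matrix_(i, j) X i j w - M) y - c))).
Proof.
have [_ X01 indX EX] := adjX.
rewrite (_ : _ \o _ = (fun w => (expR (- c))%:E * (EFin \o (fun w => expR
  (\sum_(ij in D) coef s y ij * (X ij.1 ij.2 w - M ij.1 ij.2)))) w)%E).
  apply: integrableZl => //; apply: (@integrable_expR_01 _ _ _ P _ D
    (fun ij => X ij.1 ij.2) (fun ij => M ij.1 ij.2)) => //.
by apply/funext => w /=; rewrite -EFinM -expRD addrC -qformE.
Qed.

Lemma expectation_expR_qform_le (s c : R) (y : 'I_n -> R) :
  ('E_P[(fun w => expR (s * qform (\matrix_(i, j) X i j w - M) y - c))%R] <=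
   (expR (s ^+ 2 * nsq y ^+ 2 / 4 - c))%:E)%E.
Proof.
have [_ X01 indX EX] := adjX.
have iX : P.-integrable setT (EFin \o (fun w => expR
  (\sum_(ij in D) coef s y ij * (X ij.1 ij.2 w - M ij.1 ij.2)))).
  by apply: (@integrable_expR_01 _ _ _ P _ D
    (fun ij => X ij.1 ij.2) (fun ij => M ij.1 ij.2)).
rewrite (_ : (fun w => _) = (fun w => expR (- c) * expR
  (\sum_(ij in D) coef s y ij * (X ij.1 ij.2 w - M ij.1 ij.2)))); last first.
  by apply/funext => w /=; rewrite -expRD addrC -qformE.
rewrite unlock; under eq_integral do rewrite EFinM.
rewrite integralZl//= addrC expRD EFinM lee_wpmul2l ?lee_fin ?expR_ge0//.
have := @expectation_expR_01_le _ _ _ P _ D (fun ij => X ij.1 ij.2)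
  (fun ij => M ij.1 ij.2) (fun ij => X01 ij.1 ij.2) indX
  (fun ij => EX ij.1 ij.2) (coef s y) (fun ij => M01 ij.1 ij.2).
rewrite unlock => h; apply: le_trans h _.
by rewrite lee_fin ler_expR sum_coef_sqr.
Qed.

End adjacency_tail.

(** * Rounding to integer vectors *)

Definition upd (R : realType) n (z : 'I_n -> R) (i : 'I_n) (t : R) : 'I_n -> R :=
  fun j => if j == i then t else z j.

(** In a single coordinate the form is a quadratic polynomial led by a diagonal entry, so a lower
    bound on the diagonal controls the rounding loss. *)
Lemma qform_upd (R : realType) n (B : 'M[R]_n) (z : 'I_n -> R) (i : 'I_n) :
  exists L K, forall t, qform B (upd z i t) = B i i * t ^+ 2 + L * t + K.
Proof.
exists (\sum_(j | j != i) z j * B i j + \sum_(j | j != i) z j * B j i).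
exists (\sum_(k | k != i) \sum_(j | j != i) z k * z j * B k j) => t.
rewrite /qform (bigD1 i)//= (bigD1 i)//= {1 2 3}/upd eqxx.
under eq_bigr => j ji do rewrite /upd (negbTE ji).
rewrite [X in _ + X](eq_bigr (fun k => z k * t * B k i +
    \sum_(j | j != i) z k * z j * B k j)); last first.
  move=> k ki; rewrite (bigD1 i)//= {1 2}/upd (negbTE ki) eqxx; congr (_ + _).
  by apply: eq_bigr => j ji; rewrite /upd (negbTE ki) (negbTE ji).
rewrite big_split/= -!addrA addrA.
rewrite mulrDl !mulr_suml !addrA; congr (_ + _); congr (_ + _); [congr (_ + _)|].
- by ring.
- by apply: eq_bigr => j _; ring.
- by apply: eq_bigr => j _; ring.
Qed.

(* For t rounded at random to a neighbouring integer so that its mean is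
   preserved, the mean of a t^2 changes by a times the variance, which is at
   most 1 / 4. *)
Lemma quadratic_round (R : realType) (a b L K t : R) : 0 <= b -> - b <= a ->
  exists m : int, `|m%:~R - t| <= 1 /\
    a * t ^+ 2 + L * t + K - b / 4 <= a * m%:~R ^+ 2 + L * m%:~R + K.
Proof.
move=> b0 ab; pose m := Num.floor t.
have m1 : m%:~R <= t by exact: floor_le.
have m2 : t < (m + 1)%:~R by exact: floorD1_gt.
have m2' : t < m%:~R + 1 by move: m2; rewrite intrD.
set u : R := m%:~R in m1 m2'.
pose f := fun t => a * t ^+ 2 + L * t + K.
pose p := t - u.
have p0 : 0 <= p by rewrite /p; lra.
have p1 : p <= 1 by rewrite /p; lra.
have mean : (1 - p) * f u + p * f (u + 1) = f t + a * (p * (1 - p)).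
  by rewrite /f /p; ring.
have var0 : 0 <= p * (1 - p) by rewrite mulr_ge0// subr_ge0.
have var1 : p * (1 - p) <= 1 / 4 by have := sqr_ge0 (p - 1 / 2); nra.
have low : f t - b / 4 <= f t + a * (p * (1 - p)) by nra.
have [h|h] := leP (f t - b / 4) (f u).
  by exists m; split => //; rewrite ler_norml -/u; apply/andP; split; lra.
exists (m + 1); rewrite intrD -/u; split.
  by rewrite ler_norml; apply/andP; split; lra.
rewrite -/(f t) -/(f (u + 1)) leNgt; apply/negP => h'.
(* If [p = 0] then [t = u], already excluded; otherwise both values lie below the bound and so does
   their mean. *)
have [p00|p00] := eqVneq p 0.
  by move: low mean; rewrite p00 subr0 !mul1r !mul0r mulr0 !addr0 => _ E; lra.
have pp : 0 < p by rewrite lt_neqAle eq_sym p00.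
by nra.
Qed.

Lemma qform_round (R : realType) n (B : 'M[R]_n) (b : R) (x : 'I_n -> R) :
  0 <= b -> (forall i, - b <= B i i) ->
  exists m : 'I_n -> int, (forall i, `|(m i)%:~R - x i| <= 1) /\
    qform B x - n%:R * b / 4 <= qform B (fun i => (m i)%:~R).
Proof.
move=> b0 bB.
(* The first [k] coordinates are rounded and the others untouched, so each is rounded from its
   original value, at a cost of [b / 4]. *)
suff /(_ n (leqnn n)) [z [zi _ zq]] : forall k, (k <= n)%N -> exists z : 'I_n -> R,
  [/\ forall i : 'I_n, (i < k)%N -> exists2 m : int, z i = m%:~R & `|z i - x i| <= 1,
      forall i : 'I_n, (k <= i)%N -> z i = x i &
      qform B x - k%:R * b / 4 <= qform B z].
  have {}zi i : exists m : int, z i == m%:~R /\ `|z i - x i| <= 1.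
    by have [m -> h] := zi i (ltn_ord i); exists m.
  have [m hm] := boolp.choice zi.
  exists m; split => [i|]; first by have [/eqP <-] := hm i.
  rewrite (_ : (fun i => _) = z)//.
  by apply/funext => i; have [/eqP <-] := hm i.
elim=> [_|k IH kn].
  by exists x; split => //; rewrite !mul0r subr0.
have [z [z1 z2 zq]] := IH (ltnW kn).
pose i0 := Ordinal kn.
have [L [K hLK]] := qform_upd B z i0.
have [m [hm hq]] := quadratic_round L K (z i0) b0 (bB i0).
exists (upd z i0 m%:~R); split => [i ik|i ki|].
- rewrite /upd; case: eqP => [->|ne].
    by exists m => //; rewrite -(z2 i0).
  apply: z1; rewrite ltn_neqAle -ltnS ik andbT.
  by apply/negP => /eqP e; apply: ne; apply: val_inj.
- rewrite /upd; case: eqP => [e|_]; first by rewrite e ltnn in ki.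
  by apply: z2; rewrite ltnW.
- rewrite hLK; apply: le_trans hq.
  rewrite -hLK; have -> : upd z i0 (z i0) = z.
    by apply/funext => j; rewrite /upd; case: eqP => [->|].
  by rewrite -natr1; lra.
Qed.

Lemma qform_sub_scalar (R : realType) n (A : 'M[R]_n) (c : R) (y : 'I_n -> R) :
  qform (A - c%:M) y = qform A y - c * nsq y.
Proof.
rewrite /qform /nsq mulr_sumr -sumrB; apply: eq_bigr => i _.
rewrite (bigD1 i)//= [in RHS](bigD1 i)//= !mxE eqxx mulr1n.
rewrite (eq_bigr (fun j => y i * y j * A i j)); first by ring.
by move=> j ji; rewrite !mxE eq_sym (negbTE ji) mulr0n subr0.
Qed.

Lemma qformZ (R : realType) n (A : 'M[R]_n) (c : R) (y : 'I_n -> R) :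
  qform A (fun i => c * y i) = c ^+ 2 * qform A y.
Proof.
rewrite /qform mulr_sumr; apply: eq_bigr => i _.
by rewrite mulr_sumr; apply: eq_bigr => j _; ring.
Qed.

Lemma nsqZ (R : realType) n (c : R) (y : 'I_n -> R) :
  nsq (fun i => c * y i) = c ^+ 2 * nsq y.
Proof. by rewrite /nsq mulr_sumr; apply: eq_bigr => i _; rewrite exprMn. Qed.

Lemma nsq_eq0 (R : realType) n (y : 'I_n -> R) : nsq y = 0 -> forall i, y i = 0.
Proof.
move=> y0 i; apply/eqP; rewrite -sqrf_eq0; apply/eqP.
move/psumr_eq0P : y0; apply => //= j _; exact: sqr_ge0.
Qed.

(* Rounding on the sphere |x|^2 = 4 n costs at most (1 + a sqrt n) n / 4 with
   a = 9 / 5, and 4 a + (1 + a) / 4 <= 8. *)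
Lemma qform_le_of_lattice (R : realType) n (Z : 'M[R]_n) :
  (forall i, -1 <= Z i i) ->
  (forall m : 'I_n -> int, (\sum_i `|m i|%N <= 3 * n)%N ->
    qform Z (fun i => (m i)%:~R) <=
    9 / 5 * Num.sqrt n%:R * nsq (fun i => (m i)%:~R : R)) ->
  forall x, qform Z x <= 2 * Num.sqrt n%:R * nsq x.
Proof.
move=> Z1 hlat.
suff sphere x : nsq x = 4 * n%:R -> qform Z x <= 2 * Num.sqrt n%:R * nsq x.
  move=> x; have [x0|x0] := eqVneq (nsq x) 0.
    rewrite x0 mulr0 /qform big1// => i _; rewrite big1// => j _.
    by rewrite nsq_eq0// !mul0r.
  have xgt0 : 0 < nsq x by rewrite lt_neqAle eq_sym x0 nsq_ge0.
  have n0 : 0 < n%:R :> R.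
    case: n Z Z1 hlat sphere x x0 xgt0 => [|//] _ _ _ _ x.
    by rewrite /nsq big_ord0 eqxx.
  pose c := Num.sqrt (4 * n%:R / nsq x).
  have c2 : c ^+ 2 = 4 * n%:R / nsq x by rewrite sqr_sqrtr// divr_ge0 ?mulr_ge0// ltW.
  have c0 : 0 < c ^+ 2 by rewrite c2 divr_gt0// mulr_gt0.
  have := sphere (fun i => c * x i); rewrite nsqZ qformZ c2 divfK// => /(_ erefl).
  rewrite -[X in 2 * _ * X](divfK x0) -c2 [2 * _ * _]mulrCA.
  by rewrite ler_pM2l.
move=> xn.
have [n0|npos] := posnP n.
  move: x xn; subst n => x _; rewrite /qform big_ord0 mulr_ge0//.
  exact: nsq_ge0.
set sn := Num.sqrt n%:R.
have sn2 : sn ^+ 2 = n%:R by rewrite sqr_sqrtr.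
have sn1 : 1 <= sn by rewrite -sqrtr1 ler_wsqrtr// ler1n.
(* Subtracting the scalar matrix turns the lattice hypothesis into nonpositivity of the rounded
   form. *)
have [||m [m1 mq]] := @qform_round _ n (Z - (9 / 5 * sn)%:M) (1 + 9 / 5 * sn) x.
- lra.
- by move=> i; rewrite !mxE eqxx mulr1n; have := Z1 i; lra.
have mn : (\sum_i `|m i|%N <= 3 * n)%N.
  rewrite -(ler_nat R) natr_sum natrM.
  (* Since [|t| + 1 <= t ^+ 2 / 4 + 2], the l1-norm is at most [4 n / 4 + 2 n = 3 n]. *)
  apply: (@le_trans _ _ (\sum_i (x i ^+ 2 / 4 + 2))); last first.
    rewrite big_split/= -mulr_suml -/(nsq x) xn sumr_const card_ord.
    by rewrite -mulr_natr; lra.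
  apply: ler_sum => i _.
  rewrite natr_absz intr_norm.
  apply: (@le_trans _ _ (`|x i| + 1)).
    have := ler_normD ((m i)%:~R - x i) (x i); rewrite subrK.
    by have := m1 i; lra.
  by have := sqr_ge0 (`|x i| - 2); rewrite -(real_normK (num_real (x i))); nra.
have := hlat m mn; rewrite -subr_le0 -qform_sub_scalar => h.
have := le_trans mq h; rewrite qform_sub_scalar xn -sn2.
by nra.
Qed.

(** * Frobenius and operator norms *)

(** The squared Frobenius norm. On columns it is the squared Euclidean norm, so operator norm bounds
    are written with it too. *)
Definition fro (R : realType) m n (A : 'M[R]_(m, n)) : R :=
  \sum_i \sum_j A i j ^+ 2.

Section frobenius.
Context (R : realType).
Implicit Types m n p : nat.

Lemma fro_ge0 m n (A : 'M[R]_(m, n)) : 0 <= fro A.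
Proof. by apply: sumr_ge0 => i _; apply: sumr_ge0 => j _; exact: sqr_ge0. Qed.

Lemma fro_tr m n (A : 'M[R]_(m, n)) : fro A^T = fro A.
Proof.
rewrite /fro exchange_big; apply: eq_bigr => i _.
by apply: eq_bigr => j _; rewrite mxE.
Qed.

Lemma fro_mxtrace m n (A : 'M[R]_(m, n)) : fro A = \tr (A^T *m A).
Proof.
rewrite /fro exchange_big /mxtrace; apply: eq_bigr => j _.
by rewrite mxE; apply: eq_bigr => i _; rewrite mxE expr2.
Qed.

Lemma froD_le m n (A B : 'M[R]_(m, n)) : fro (A + B) <= 2 * fro A + 2 * fro B.
Proof.
rewrite /fro !mulr_sumr -big_split; apply: ler_sum => i _.
rewrite !mulr_sumr -big_split; apply: ler_sum => j _; rewrite /= mxE.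
by have := sqr_ge0 (A i j - B i j); nra.
Qed.

Lemma fro_orthonormal m n p (U : 'M[R]_(m, n)) (A : 'M[R]_(n, p)) :
  U^T *m U = 1%:M -> fro (U *m A) = fro A.
Proof.
by move=> U1; rewrite !fro_mxtrace trmx_mul mulmxA -(mulmxA A^T) U1 mulmx1.
Qed.

(** Pythagoras for the rows of [A] and the orthogonal projection [Q]. *)
Lemma fro_proj_split m n (Q : 'M[R]_n) (A : 'M[R]_(m, n)) :
  Q^T = Q -> Q *m Q = Q -> fro A = fro (A *m Q) + fro (A *m (1%:M - Q)).
Proof.
move=> QT QQ.
have QC : (1%:M - Q) *m (1%:M - Q) = 1%:M - Q.
  by rewrite mulmxBr mulmx1 mulmxBl mul1mx QQ subrr subr0.
have froM B : fro (A *m B) = \tr (A *m (B *m B^T) *m A^T).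
  by rewrite -fro_tr fro_mxtrace trmxK trmx_mul !mulmxA.
have -> : fro A = \tr (A *m A^T) by rewrite -fro_tr fro_mxtrace trmxK.
rewrite !froM QT QQ linearB/= trmx1 QT QC.
by rewrite -mxtraceD -mulmxDl -mulmxDr addrC subrK mulmx1.
Qed.

Lemma fro_proj_le m n (Q : 'M[R]_n) (A : 'M[R]_(m, n)) :
  Q^T = Q -> Q *m Q = Q -> fro (A *m (1%:M - Q)) <= fro A.
Proof. by move=> QT QQ; rewrite (fro_proj_split A QT QQ) lerDr fro_ge0. Qed.

Lemma fro_cols m n (A : 'M[R]_(m, n)) : fro A = \sum_j fro (col j A).
Proof.
rewrite /fro exchange_big; apply: eq_bigr => j _.
by apply: eq_bigr => i _; rewrite big_ord1 mxE.
Qed.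

Lemma fro_mul_le m n p (B : 'M[R]_(m, n)) (A : 'M[R]_(n, p)) (c : R) :
  (forall x : 'cV_n, fro (B *m x) <= c * fro x) -> fro (B *m A) <= c * fro A.
Proof.
move=> Bc; rewrite !fro_cols mulr_sumr; apply: ler_sum => j _.
by rewrite !colE -mulmxA; apply: Bc.
Qed.

Lemma fro_diag_mul m n (s : 'rV[R]_m) (A : 'M[R]_(m, n)) :
  fro (diag_mx s *m A) = \sum_i s 0 i ^+ 2 * \sum_j A i j ^+ 2.
Proof.
rewrite /fro; apply: eq_bigr => i _; rewrite mulr_sumr; apply: eq_bigr => j _.
by rewrite mul_diag_mx mxE exprMn.
Qed.

Let bform n (A : 'M[R]_n) (u v : 'cV[R]_n) := (u^T *m A *m v) 0 0.

Let qformE n (A : 'M[R]_n) (u : 'cV[R]_n) :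
  qform A (fun i => u i 0) = bform A u u.
Proof.
rewrite /bform /qform mxE exchange_big; apply: eq_bigr => j _.
by rewrite mxE mulr_suml; apply: eq_bigr => i _; rewrite mxE; ring.
Qed.

Let nsqE n (u : 'cV[R]_n) : nsq (fun i => u i 0) = fro u.
Proof. by rewrite /nsq /fro; apply: eq_bigr => i _; rewrite big_ord1. Qed.

(* Polarization, tested on the vectors A x and tau x. *)
Lemma qform_le_opnorm n (A : 'M[R]_n) (tau : R) : 0 < tau -> A^T = A ->
  (forall x, qform A x <= tau * nsq x) ->
  (forall x, qform (- A) x <= tau * nsq x) ->
  forall x : 'cV_n, fro (A *m x) <= tau ^+ 2 * fro x.
Proof.
move=> tau0 AT h1 h2 x.
pose u := A *m x; pose v := tau *: x.
have := lerD (h1 (fun i => (u + v) i 0)) (h2 (fun i => (u - v) i 0)).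
rewrite !qformE !nsqE -mulrDr.
have -> : fro (u + v) + fro (u - v) = 2 * fro u + 2 * fro v.
  rewrite /fro !mulr_sumr -!big_split; apply: eq_bigr => i _ /=.
  rewrite !mulr_sumr -!big_split; apply: eq_bigr => j _ /=.
  by rewrite !mxE; ring.
have -> : bform A (u + v) (u + v) + bform (- A) (u - v) (u - v) =
    4 * bform A u v.
  have AC : bform A v u = bform A u v.
    rewrite /bform -[LHS]trace_mx11 -[RHS]trace_mx11 -mxtrace_tr.
    by rewrite !trmx_mul trmxK AT mulmxA.
  have addE (B C : 'M[R]_1) : (B + C) 0 0 = B 0 0 + C 0 0 by rewrite mxE.
  have DE a b : bform A (a + b) (a + b) =
      bform A a a + bform A a b + bform A b a + bform A b b.
    by rewrite /bform [(a + b)^T]linearD/= !(mulmxDl, mulmxDr) !addE; ring.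
  have -> : bform (- A) (u - v) (u - v) = - bform A (u - v) (u - v).
    by rewrite /bform mulmxN mulNmx [LHS]mxE.
  have bN a : bform A a (- v) = - bform A a v by rewrite /bform mulmxN [LHS]mxE.
  have Nb a : bform A (- v) a = - bform A v a.
    by rewrite /bform [(- v)^T]linearN/= !mulNmx [LHS]mxE.
  by rewrite !DE !bN !Nb AC; ring.
have -> : bform A u v = tau * fro u.
  rewrite /bform /v -scalemxAr mxE; congr (_ * _).
  by rewrite -mulmxA -/u fro_mxtrace trace_mx11.
have -> : fro v = tau ^+ 2 * fro x.
  rewrite /fro mulr_sumr; apply: eq_bigr => i _; rewrite mulr_sumr.
  by apply: eq_bigr => j _; rewrite mxE exprMn.
(* The inequality reads [4 tau |u|^2 <= tau (2 |u|^2 + 2 tau^2 |x|^2)]. *)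
rewrite mulrCA ler_pM2l//.
by rewrite -/u; lra.
Qed.

End frobenius.

(** * Deterministic error bound *)

Lemma sum_col_mul_diag (R : realType) n (I : pred 'I_n) (s : 'I_n -> R)
    (U V : 'M[R]_n) :
  \sum_(i < n | I i) s i *: (col i U *m (col i V)^T) =
  U *m diag_mx (\row_i (if I i then s i else 0)) *m V^T.
Proof.
apply/matrixP => a b; rewrite summxE mxE [LHS]big_mkcond; apply: eq_bigr => i _.
rewrite mul_mx_diag !mxE big_ord1 !mxE.
by case: (I i); rewrite ?mulr0 ?mul0r//; ring.
Qed.

Section usvt_deterministic.
Context (R : realType) (n : nat).
Variables (A M Q U V : 'M[R]_n) (s : 'I_n -> R) (t tau : R).
Hypotheses (svdA : is_svd A s U V) (tau0 : 0 <= tau) (taut : tau < t)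
  (ZT : (A - M)^T = A - M)
  (Zop : forall x : 'cV_n, fro ((A - M) *m x) <= tau ^+ 2 * fro x)
  (QT : Q^T = Q) (QQ : Q *m Q = Q) (MQ : M *m Q = M).

Let Z := A - M.
Let W := \sum_(i < n | t <= s i) s i *: (col i U *m (col i V)^T).
Let De := diag_mx (\row_i (if t <= s i then 1 else 0 : R)).
Let Ds := diag_mx (\row_i s i).

Let U1 : U^T *m U = 1%:M. Proof. by case: svdA. Qed.
Let V1 : V^T *m V = 1%:M. Proof. by case: svdA. Qed.
Let s0 i : 0 <= s i. Proof. by case: svdA. Qed.
Let AE : A = U *m Ds *m V^T.
Proof. by case: svdA => _ _ _ ->; rewrite sum_col_mul_diag. Qed.

Let De2 i : (if t <= s i then 1 else 0 : R) ^+ 2 = if t <= s i then 1 else 0.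
Proof. by case: ifP => _; rewrite ?expr1n ?expr0n. Qed.

Let froV m (B : 'M[R]_(n, m)) : fro (V^T *m B) = fro B.
Proof. by apply: fro_orthonormal; rewrite trmxK; apply: mulmx1C. Qed.

Let UA : U^T *m A = Ds *m V^T.
Proof. by rewrite AE !mulmxA U1 mul1mx. Qed.

(** [W] is the image of [A] under the orthogonal projection on the span of the retained left
    singular vectors. *)
Let WE : W = U *m (De *m (U^T *m A)).
Proof.
rewrite UA /W sum_col_mul_diag !mulmxA; congr (_ *m _); rewrite -!mulmxA.
congr (_ *m _); apply/matrixP => i j; rewrite mul_diag_mx !mxE.
by case: ifP => _; rewrite ?mul1r ?mul0r ?mul0rn.
Qed.

(** Up to sign, [W - A] has only the discarded singular values, all below [t]. *)
Let WA_op (x : 'cV_n) : fro ((W - A) *m x) <= t ^+ 2 * fro x.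
Proof.
have -> : W - A = U *m (diag_mx (\row_i (if t <= s i then 0 else - s i)) *m V^T).
  rewrite /W sum_col_mul_diag AE -mulmxBl -mulmxBr -mulmxA; congr (_ *m (_ *m _)).
  apply/matrixP => i j; rewrite !mxE -mulrnBl; congr (_ *+ _).
  by case: ifP => _; rewrite ?subrr ?sub0r.
rewrite -mulmxA fro_orthonormal// -mulmxA fro_diag_mul -(froV x) /fro mulr_sumr.
apply: ler_sum => i _; apply: ler_wpM2r.
  by apply: sumr_ge0 => j _; exact: sqr_ge0.
rewrite mxE; have h := s0 i; case: (leP t (s i)) => h'; rewrite ?expr0n/= ?sqr_ge0//.
by rewrite sqrrN; nra.
Qed.

Let fro_De_le m (B : 'M[R]_(n, m)) : fro (De *m B) <= fro B.
Proof.
rewrite fro_diag_mul; apply: ler_sum => i _; rewrite mxE De2.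
have : 0 <= \sum_j B i j ^+ 2 by apply: sumr_ge0 => j _; exact: sqr_ge0.
by case: ifP => _; rewrite ?mul1r ?mul0r.
Qed.

Let ker_Q : A *m (1%:M - Q) = Z *m (1%:M - Q).
Proof. by rewrite /Z mulmxBl !mulmxBr MQ !mulmx1 subrr subr0. Qed.

(** On the kernel of [Q], [A] acts as the noise [Z]. After dropping the projection, the transpose
    [Z *m (U *m De)] is bounded column by column. *)
Let head_ker_le : fro (De *m (U^T *m A) *m (1%:M - Q)) <= tau ^+ 2 * fro De.
Proof.
rewrite -mulmxA -(mulmxA _ A) ker_Q !mulmxA.
apply: le_trans (fro_proj_le _ QT QQ) _.
rewrite -[leLHS]fro_tr !trmx_mul trmxK ZT tr_diag_mx.
apply: le_trans (fro_mul_le (U *m De) Zop) _.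
by rewrite fro_orthonormal.
Qed.

(* [fro De] is the number of retained singular values; their right singular
   vectors are close to the range of Q, whose dimension is [fro Q]. *)
Let count_le : (t ^+ 2 - tau ^+ 2) * fro De <= t ^+ 2 * fro Q.
Proof.
have -> : fro De = fro (De *m V^T).
  by rewrite -[RHS]fro_tr trmx_mul trmxK fro_orthonormal// fro_tr.
have h1 : fro (De *m V^T *m Q) <= fro Q.
  by rewrite -mulmxA; apply: le_trans (fro_De_le _) _; rewrite froV.
(* Row by row, [De *m (U^T *m A)] is [De *m V^T] scaled by the singular values, and the retained
   ones are at least [t]. *)
have h2 : t ^+ 2 * fro (De *m V^T *m (1%:M - Q)) <= tau ^+ 2 * fro (De *m V^T).
  have <- : fro De = fro (De *m V^T).
    by rewrite -[RHS]fro_tr trmx_mul trmxK fro_orthonormal// fro_tr.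
  apply: le_trans head_ker_le.
  rewrite UA -!mulmxA !fro_diag_mul mulr_sumr; apply: ler_sum => i _.
  rewrite mxE De2; case: ifPn => ts; last by rewrite !mul0r mulr0.
  rewrite !mul1r mulr_sumr; apply: ler_sum => j _.
  rewrite mul_diag_mx !mxE exprMn; apply: ler_wpM2r; first exact: sqr_ge0.
  by rewrite ler_sqr ?nnegrE//; have := tau0; have := taut; lra.
have := fro_proj_split (De *m V^T) QT QQ.
have t2 : 0 <= t ^+ 2 by exact: sqr_ge0.
by nra.
Qed.

(** The factor [t ^+ 2 - tau ^+ 2] on the left lets [count_le] be used without division. *)
Lemma usvt_error_le : (t ^+ 2 - tau ^+ 2) * fro (W - M) <=
  ((2 * t ^+ 2 + 2 * tau ^+ 2) * (t ^+ 2 - tau ^+ 2) + tau ^+ 2 * t ^+ 2) * fro Q.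
Proof.
have gap : 0 <= t ^+ 2 - tau ^+ 2 by have := tau0; have := taut; nra.
have h1 : fro ((W - M) *m Q) <= (2 * t ^+ 2 + 2 * tau ^+ 2) * fro Q.
  have -> : W - M = (W - A) + Z by rewrite /Z addrA subrK.
  rewrite mulmxDl; apply: le_trans (froD_le _ _) _.
  have := fro_mul_le Q WA_op; have := fro_mul_le Q Zop.
  by rewrite -/Z; lra.
have h2 : fro ((W - M) *m (1%:M - Q)) <= tau ^+ 2 * fro De.
  have -> : (W - M) *m (1%:M - Q) = W *m (1%:M - Q).
    by rewrite mulmxBl [M *m _]mulmxBr mulmx1 MQ subrr subr0.
  by rewrite WE -mulmxA fro_orthonormal//; exact: head_ker_le.
have h3 := ler_wpM2l (sqr_ge0 tau) count_le.
have h4 := ler_wpM2l gap (lerD h1 h2).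
rewrite (fro_proj_split (W - M) QT QQ); apply: le_trans h4 _.
by lra.
Qed.

End usvt_deterministic.

(** * Averaging over blocks *)

Section block_average.
Context (R : realType) (n : nat).
Variable (B : {set {set 'I_n}}).
Hypothesis partB : finset.partition B [set: 'I_n]%SET.

Let cell := finset.pblock B.

(** The orthogonal projection on blockwise constant vectors: each entry is replaced by its mean over
    the cell. *)
Definition block_average : 'M[R]_n :=
  \matrix_(i, j) (if cell i == cell j then (#|cell j|%:R)^-1 else 0).

Let trivB : finset.trivIset B. Proof. by case/and3P: partB. Qed.
Let coverB : finset.cover B = [set: 'I_n]%SET.
Proof. by case/and3P: partB => /eqP. Qed.

Let mem_cell i : i \in cell i.
Proof. by rewrite finset.mem_pblock coverB finset.inE. Qed.

Let eq_cell i j : (cell i == cell j) = (i \in cell j).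
Proof. by rewrite eq_sym finset.eq_pblock ?coverB ?finset.inE. Qed.

Let card_cell_neq0 i : #|cell i|%:R != 0 :> R.
Proof. by rewrite pnatr_eq0 -lt0n; apply/card_gt0P; exists i. Qed.

Lemma mulmx_block_average (A : 'M[R]_n) :
  (forall i j j', cell j = cell j' -> A i j = A i j') ->
  A *m block_average = A.
Proof.
move=> Acst; apply/matrixP => i j; rewrite mxE.
rewrite (eq_bigr (fun l => if l \in cell j then A i j / #|cell j|%:R else 0)).
  rewrite -big_mkcond/= sumr_const -[LHS]mulr_natr divfK//.
by move=> l _; rewrite mxE eq_cell; case: ifP => [|_]; rewrite ?mulr0// -eq_cell =>
  /eqP /(Acst i) ->.
Qed.

Lemma tr_block_average : block_average^T = block_average.
Proof.
apply/matrixP => i j; rewrite !mxE eq_sym.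
by case: ifP => // /eqP ->.
Qed.

Lemma block_average_idem : block_average *m block_average = block_average.
Proof. by apply: mulmx_block_average => i j j' e; rewrite !mxE e. Qed.

(** For an orthogonal projection [fro] is the trace, here a sum to which each cell contributes 1. *)
Lemma fro_block_average : fro block_average = #|B|%:R.
Proof.
rewrite fro_mxtrace tr_block_average block_average_idem /mxtrace.
rewrite (eq_bigl (fun i => i \in finset.cover B)); last first.
  by move=> i; rewrite coverB finset.inE.
rewrite finset.big_trivIset//= (eq_bigr (fun=> 1)) ?sumr_const//.
move=> b bB; rewrite (eq_bigr (fun=> (#|b|%:R)^-1)).
  (* Cells are nonempty, so the inverse of the cardinality is a genuine one. *)
  have [i ib] : exists i, i \in b.
    apply/finset.set0Pn; apply/eqP => b0; subst b.
    by case/and3P: partB => _ _ /negP.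
  by rewrite sumr_const -[LHS]mulr_natr mulVf// -(finset.def_pblock trivB bB ib).
by move=> i ib; rewrite mxE eqxx /cell (finset.def_pblock trivB bB ib).
Qed.

End block_average.

(** * Union bound over integer vectors *)

(* Sign and absolute value of the entries of an integer vector of l1-norm at
   most 3 n. *)
Definition lattice_code n := {ffun 'I_n -> bool * 'I_(3 * n).+1}.

Definition small_code n (c : lattice_code n) := (\sum_i (c i).2 <= 3 * n)%N.

Definition lattice_vec (R : realType) n (c : lattice_code n) (i : 'I_n) : R :=
  (-1) ^+ (c i).1 * (c i).2%:R.

(** A zero entry has two codes; overcounting is harmless in a union bound. *)
Lemma lattice_vec_surj (R : realType) n (m : 'I_n -> int) :
  (\sum_i `|m i|%N <= 3 * n)%N ->
  exists2 c : lattice_code n, small_code c &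
    (fun i => (m i)%:~R) = lattice_vec R c.
Proof.
move=> hm.
have mle i : (`|m i|%N < (3 * n).+1)%N.
  by rewrite ltnS (leq_trans _ hm)// (bigD1 i)//= leq_addr.
exists [ffun i => (m i < 0, Ordinal (mle i))].
  rewrite /small_code; apply: leq_trans hm; apply: leq_sum => i _.
  by rewrite ffunE.
apply/funext => i; rewrite /lattice_vec ffunE /= natr_absz -[in LHS](mulr_sign_norm (m i)).
by rewrite intrM rmorphXn/= rmorphN1.
Qed.

Lemma sum_geometric_le (R : realType) N : \sum_(i < N) (3 / 4 : R) ^+ i <= 4.
Proof.
suff -> : \sum_(i < N) (3 / 4 : R) ^+ i = 4 - 4 * (3 / 4) ^+ N.
  by rewrite lerBlDr lerDl mulr_ge0// exprn_ge0// divr_ge0.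
elim: N => [|N IH]; first by rewrite big_ord0 expr0; ring.
by rewrite big_ord_recr/= IH exprS; field.
Qed.

(* Chernoff bound for the counting measure, with weight (3 / 4)^|z|. *)
Lemma card_small_code (R : realType) n :
  \sum_(c : lattice_code n | small_code c) (1 : R) <= (8 * (4 / 3) ^+ 3) ^+ n.
Proof.
pose F (p : bool * 'I_(3 * n).+1) : R := (3 / 4) ^+ p.2.
have F0 p : 0 <= F p by rewrite exprn_ge0// divr_ge0.
apply: (@le_trans _ _ (\sum_(c : lattice_code n) ((4 / 3) ^+ 3) ^+ n * \prod_i F (c i))).
  rewrite big_mkcond/=; apply: ler_sum => c _; case: ifPn => hc; last first.
    by rewrite mulr_ge0 ?prodr_ge0// exprn_ge0// divr_ge0.
  rewrite /F prodrXr.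
  have : 1 = ((4 / 3) ^+ 3) ^+ n * (3 / 4 : R) ^+ (3 * n).
    by rewrite exprM -exprMn (_ : _ * _ = 1) ?expr1n//; field.
  move=> {1}->; apply: ler_wpM2l; first by rewrite exprn_ge0// divr_ge0.
  by apply: ler_wiXn2l => //; lra.
rewrite -mulr_sumr -(bigA_distr_bigA (fun _ : 'I_n => F)) prodr_const card_ord -exprMn.
apply: lerXn2r; rewrite ?nnegrE ?mulr_ge0 ?divr_ge0 ?sumr_ge0//.
(* Two signs times a geometric sum of at most 4 give the factor 8. *)
have -> : \sum_p F p = \sum_(b : bool) \sum_(m < (3 * n).+1) (3 / 4) ^+ m.
  by rewrite pair_bigA/=.
rewrite big_bool/=; have := sum_geometric_le R (3 * n).+1; lra.
Qed.


(** The exponential is bounded through [expR (81 / 25) >= (1 + 27 / 200) ^+ 24]; the exponents 2, 4,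
    8, 24 are reached in turn, with rational lower bounds. *)
Lemma lattice_union_rate (R : realType) :
  8 * (4 / 3) ^+ 3 * expR (- (81 / 25)) <= 29 / 30 :> R.
Proof.
rewrite expRN ler_pdivrMr ?expR_gt0//.
have [y yE] : exists y : R, y = 1 + 27 / 200 by exists (1 + 27 / 200).
have h2 : 9 / 7 <= y ^+ 2 by rewrite yE; lra.
have h4 : 33 / 20 <= y ^+ 4.
  rewrite (exprM y 2 2); apply: (@le_trans _ _ ((9 / 7) ^+ 2)); first lra.
  by apply: lerXn2r; rewrite ?nnegrE ?(le_trans _ h2) ?divr_ge0.
have h8 : 27 / 10 <= y ^+ 8.
  rewrite (exprM y 4 2); apply: (@le_trans _ _ ((33 / 20) ^+ 2)); first lra.
  by apply: lerXn2r; rewrite ?nnegrE ?(le_trans _ h4) ?divr_ge0.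
have h24 : (27 / 10) ^+ 3 <= y ^+ 24.
  by rewrite (exprM y 8 3); apply: lerXn2r; rewrite ?nnegrE ?(le_trans _ h8) ?divr_ge0.
have h : y ^+ 24 <= expR (81 / 25).
  have -> : 81 / 25 = 24%:R * (27 / 200) :> R by field.
  rewrite expRM_natl yE; apply: lerXn2r; rewrite ?nnegrE ?expR_ge0 ?addr_ge0 ?divr_ge0//.
  exact: expR_ge1Dx.
have := le_trans h24 h; clear; lra.
Qed.

(** The integral of a nonnegative function is a supremum over simple functions below it, hence
    monotone even without measurability. *)
Lemma ge0_expectation_mono d (T : measurableType d) (R : realType)
    (P : probability T R) (f g : T -> R) :
  (forall w, 0 <= f w) -> (forall w, f w <= g w) -> ('E_P[f] <= 'E_P[g])%E.
Proof.
move=> f0 fg; have g0 w : 0 <= g w := le_trans (f0 w) (fg w).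
rewrite unlock !ge0_integralTE; [|by move=> w; rewrite lee_fin..].
apply: le_ereal_sup => _ [h /= hf <-]; exists h => // w.
by apply: le_trans (hf w) _; rewrite lee_fin.
Qed.

(* The sum of the Chernoff bounds for the events +-z^T Z z > a sqrt n |z|^2, with
   a = 9 / 5 and the optimal parameter 2 a sqrt n / |z|^2. Using it as a pointwise
   majorant of the bad event avoids any measurability question about the
   estimator. *)
Definition lattice_excess (R : realType) n (Z : 'M[R]_n) : R :=
  \sum_(c : lattice_code n | small_code c && (0 < nsq (lattice_vec R c)))
  \sum_(b : bool)
    expR ((-1) ^+ b * (18 / 5 * Num.sqrt n%:R / nsq (lattice_vec R c)) *
          qform Z (lattice_vec R c) - 162 / 25 * n%:R).

Lemma lattice_excess_ge0 (R : realType) n (Z : 'M[R]_n) : 0 <= lattice_excess Z.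
Proof.
by apply: sumr_ge0 => c _; apply: sumr_ge0 => b _; exact: expR_ge0.
Qed.

Lemma qformZl (R : realType) n (a : R) (A : 'M[R]_n) (y : 'I_n -> R) :
  qform (a *: A) y = a * qform A y.
Proof.
rewrite /qform mulr_sumr; apply: eq_bigr => i _.
by rewrite mulr_sumr; apply: eq_bigr => j _; rewrite mxE; ring.
Qed.

(** If a sum of exponentials is below 1, every exponent is negative, which is the lattice hypothesis
    for both signs of [Z]. *)
Lemma lattice_excess_lt1 (R : realType) n (Z : 'M[R]_n) (b : bool) :
  (0 < n)%N -> lattice_excess Z < 1 -> (forall i, `|Z i i| <= 1) ->
  forall x, qform ((-1) ^+ b *: Z) x <= 2 * Num.sqrt n%:R * nsq x.
Proof.
move=> n0 ex1 Z1; apply: qform_le_of_lattice => [i|m /lattice_vec_surj].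
  rewrite mxE; have := Z1 i; rewrite ler_norml.
  by case: b; rewrite ?expr0 ?expr1; lra.
move=> /(_ R)[c sc ->]; set y := lattice_vec R c.
have [y0|y0] := eqVneq (nsq y) 0.
  rewrite y0 mulr0 /qform big1// => i _; rewrite big1// => j _.
  by rewrite nsq_eq0// !mul0r.
have {}y0 : 0 < nsq y by rewrite lt_neqAle eq_sym y0 nsq_ge0.
have sn0 : 0 < Num.sqrt n%:R :> R by rewrite sqrtr_gt0 ltr0n.
have : expR ((-1) ^+ b * (18 / 5 * Num.sqrt n%:R / nsq y) * qform Z y
             - 162 / 25 * n%:R) < 1.
  apply: le_lt_trans ex1.
  rewrite /lattice_excess (bigD1 c)/=; last by rewrite sc.
  rewrite (bigD1 b)//= -addrA lerDl addr_ge0//.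
    by apply: sumr_ge0 => ? _; exact: expR_ge0.
  by apply: sumr_ge0 => ? _; apply: sumr_ge0 => ? _; exact: expR_ge0.
rewrite expR_lt1 subr_lt0 -{2}(sqr_sqrtr (ler0n R n)) qformZl.
set sn := Num.sqrt _ in sn0 *; set q := (-1) ^+ b * qform Z y.
have -> : (-1) ^+ b * (18 / 5 * sn / nsq y) * qform Z y = 18 / 5 * sn * q / nsq y.
  by rewrite /q; ring.
rewrite ltr_pdivrMr//.
have -> : 162 / 25 * sn ^+ 2 * nsq y = 18 / 5 * sn * (9 / 5 * sn * nsq y) by field.
by rewrite ltr_pM2l ?mulr_gt0//; exact: ltW.
Qed.

Lemma lattice_excess_opnorm (R : realType) n (Z : 'M[R]_n) :
  (0 < n)%N -> lattice_excess Z < 1 -> (forall i, `|Z i i| <= 1) -> Z^T = Z ->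
  forall x : 'cV_n, fro (Z *m x) <= (2 * Num.sqrt n%:R) ^+ 2 * fro x.
Proof.
move=> n0 ex1 Z1 ZT; apply: qform_le_opnorm => //.
- by rewrite mulr_gt0// sqrtr_gt0 ltr0n.
- by have := lattice_excess_lt1 false n0 ex1 Z1; rewrite expr0 scale1r.
- by have := lattice_excess_lt1 true n0 ex1 Z1; rewrite expr1 scaleN1r.
Qed.

Section expected_excess.
Context d (T : measurableType d) (R : realType) (P : probability T R) (n : nat).
Variables (M : 'M[R]_n) (X : 'I_n -> 'I_n -> {RV P >-> R}).
Hypotheses (adjX : adjacency_RVs M X) (M01 : forall i j, 0 <= M i j <= 1).

Let Z w := \matrix_(i, j) X i j w - M.

Let lamb (b : bool) (y : 'I_n -> R) :=
  (-1) ^+ b * (18 / 5 * Num.sqrt n%:R / nsq y).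

Let term (b : bool) (y : 'I_n -> R) w :=
  expR (lamb b y * qform (Z w) y - 162 / 25 * n%:R).

Let integrable_term b y : P.-integrable setT (EFin \o term b y).
Proof. exact: integrable_expR_qform. Qed.

(** With [a = 9 / 5], the exponent is [a^2 n] from the moment bound minus [2 a^2 n = 162 / 25 n]. *)
Let E_term_le b (y : 'I_n -> R) : 0 < nsq y ->
  ('E_P[term b y] <= (expR (- (81 / 25)) ^+ n)%:E)%E.
Proof.
move=> y0; apply: le_trans (expectation_expR_qform_le adjX M01 _ _ _) _.
rewrite lee_fin -expRM_natl ler_expR /lamb exprMn sqrr_sign mul1r.
rewrite !exprMn sqr_sqrtr// exprVn.
rewrite le_eqVlt; apply/orP; left; apply/eqP.
have yn : nsq y != 0 by rewrite gt_eqF.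
by field.
Qed.

Let excessE : (fun w => lattice_excess (Z w)) =
  (fun w => \sum_(cb : lattice_code n * bool)
    (small_code cb.1 && (0 < nsq (lattice_vec R cb.1)))%:R *
     term cb.2 (lattice_vec R cb.1) w).
Proof.
apply/funext => w; rewrite /lattice_excess big_mkcond/= -(pair_bigA _
  (fun c b => (small_code c && (0 < nsq (lattice_vec R c)))%:R *
     term b (lattice_vec R c) w))/=; apply: eq_bigr => c _.
case: ifP => _; last by rewrite big1// => b _; rewrite mul0r.
by apply: eq_bigr => b _; rewrite mul1r.
Qed.

Lemma integrable_lattice_excess :
  P.-integrable setT (EFin \o (fun w => lattice_excess (Z w))).
Proof. by rewrite excessE; apply: integrable_lincomb => cb; exact: integrable_term. Qed.

Lemma expectation_lattice_excess_le :
  ('E_P[(fun w => lattice_excess (Z w))] <= (2 * (29 / 30) ^+ n)%:E)%E.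
Proof.
rewrite excessE expectation_lincomb; last by move=> cb; exact: integrable_term.
apply: (@le_trans _ _ (\sum_(cb : lattice_code n * bool)
    ((small_code cb.1)%:R * expR (- (81 / 25)) ^+ n)%:E)%E).
  apply: lee_sum => -[c b] _ /=.
  have e0 : 0 <= expR (- (81 / 25)) ^+ n :> R by rewrite exprn_ge0// expR_ge0.
  case: (small_code c) => /=; last by rewrite mul0e mul0r.
  case: ltP => y0 /=; last by rewrite mul0e mul1r lee_fin.
  by rewrite mul1e mul1r E_term_le.
rewrite sumEFin lee_fin -mulr_suml.
rewrite -(pair_bigA _ (fun c b => (small_code c)%:R))/=.
apply: (@le_trans _ _ (2 * (8 * (4 / 3) ^+ 3) ^+ n * expR (- (81 / 25)) ^+ n)).
  apply: ler_wpM2r; first by rewrite exprn_ge0// expR_ge0.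
  under eq_bigr do rewrite sumr_const card_bool -[_ *+ 2]mulr_natl.
  rewrite -mulr_sumr ler_pM2l//; apply: le_trans (card_small_code R n).
  by rewrite [leRHS]big_mkcond/=; apply: ler_sum => c _; case: (small_code c).
rewrite -mulrA -exprMn ler_pM2l//; apply: lerXn2r; rewrite ?nnegrE.
- by rewrite mulr_ge0 ?expR_ge0// divr_ge0.
- by rewrite divr_ge0.
- exact: lattice_union_rate.
Qed.

End expected_excess.

(** * Mean squared error *)

Lemma norm_trunc1_le1 (R : realType) (w : R) : `|Defs.trunc1 w| <= 1.
Proof.
rewrite /Defs.trunc1; case: ifPn => // _.
by case: ifP => _; rewrite ?normrN normr1.
Qed.

(** Truncation moves [w] towards every point of [-1, 1]. *)
Lemma trunc1_sqr_le (R : realType) (w m : R) : 0 <= m <= 1 ->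
  (Defs.trunc1 w - m) ^+ 2 <= (w - m) ^+ 2.
Proof.
move=> m01; rewrite /Defs.trunc1; case: ifPn => // h1; case: ifPn => h2.
  by nra.
have : w < -1.
  by move: h1 h2; rewrite ler_norml -leNgt negb_and -!ltNge => /orP[] *; lra.
by nra.
Qed.

Lemma trunc1_sqr_le4 (R : realType) (w m : R) : 0 <= m <= 1 ->
  (Defs.trunc1 w - m) ^+ 2 <= 4.
Proof.
by move=> m01; have := norm_trunc1_le1 w; rewrite ler_norml => h; nra.
Qed.

(** Both squared thresholds are multiples of [n], so dividing [usvt_error_le] by the gap
    [n ((2 + eta)^2 - 4)] leaves one factor [n]; the gap is positive because [eta] is. *)
Lemma usvt_estimate_error_le (R : realType) (eta : R) n k (M A Mhat : 'M[R]_n) :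
  0 < eta -> (0 < n)%N -> blockmodel k M -> (A - M)^T = A - M ->
  (forall i, `|(A - M) i i| <= 1) -> lattice_excess (A - M) < 1 ->
  usvt_estimate eta A Mhat ->
  fro (Mhat - M) <=
  (2 * (2 + eta) ^+ 2 + 8 + 4 * (2 + eta) ^+ 2 / ((2 + eta) ^+ 2 - 4)) *
  (n%:R * k%:R).
Proof.
move=> e0 n0 [_ M01 [B [partB cardB Mcst]]] ZT Z1 ex1 [s [U [V [svdA ->]]]].
set W := (X in map_mx _ X).
have trunc_le : fro (map_mx (@Defs.trunc1 R) W - M) <= fro (W - M).
  apply: ler_sum => i _; apply: ler_sum => j _.
  by rewrite !mxE; apply: trunc1_sqr_le.
apply: le_trans trunc_le _.
have sn0 : 0 < Num.sqrt n%:R :> R by rewrite sqrtr_gt0 ltr0n.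
have MQ : M *m block_average R B = M.
  by apply: mulmx_block_average => // i j j' e; apply: Mcst.
have tau0 : 0 <= 2 * Num.sqrt n%:R :> R by rewrite mulr_ge0// ltW.
have taut : 2 * Num.sqrt n%:R < (2 + eta) * Num.sqrt n%:R by rewrite ltr_pM2r//; lra.
have := usvt_error_le svdA tau0 taut ZT (lattice_excess_opnorm n0 ex1 Z1 ZT)
  (tr_block_average R B) (block_average_idem R partB) MQ.
rewrite fro_block_average// cardB -/W.
set F := fro _; rewrite !exprMn sqr_sqrtr//.
set t := (2 + eta) ^+ 2.
have n0' : 0 < n%:R :> R by rewrite ltr0n.
have g0 : 0 < t - 4 by rewrite /t; nra.
have -> : (t * n%:R - 2 ^+ 2 * n%:R) * F = n%:R * (t - 4) * F by ring.
have -> : ((2 * (t * n%:R) + 2 * (2 ^+ 2 * n%:R)) * (t * n%:R - 2 ^+ 2 * n%:R) +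
    2 ^+ 2 * n%:R * (t * n%:R)) * k%:R =
  n%:R * (t - 4) * ((2 * t + 8 + 4 * t / (t - 4)) * (n%:R * k%:R)).
  by have := gt_eqF g0 => /negbT ?; field.
by rewrite ler_pM2l// mulr_gt0.
Qed.

(** Bernoulli's inequality for [30 / 29] bounds the power by [29 / n], and [1 / n ^+ 2 <= k / n]. *)
Lemma geometric_le_sqrt (R : realType) (n k : nat) : (0 < k)%N -> (0 < n)%N ->
  (29 / 30 : R) ^+ n <= 29 * Num.sqrt (k%:R / n%:R).
Proof.
move=> k0 n0.
have n0' : 0 < n%:R :> R by rewrite ltr0n.
have n1 : 1 <= n%:R :> R by rewrite ler1n.
have k1 : 1 <= k%:R :> R by rewrite ler1n.
have bern : n%:R / 29 <= (30 / 29 : R) ^+ n.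
  have {n0 n0' n1} : forall m : nat, 1 + m%:R / 29 <= (30 / 29 : R) ^+ m.
    elim=> [|m IH]; first by rewrite expr0; lra.
    rewrite exprS -natr1; have := ler0n R m; lra.
  by move=> /(_ n); lra.
apply: (@le_trans _ _ (29 / n%:R)).
  rewrite -[X in X ^+ n](invf_div 30 29) exprVn -[leRHS](invf_div n%:R 29).
  by rewrite lef_pV2 ?posrE ?exprn_gt0 ?divr_gt0.
rewrite ler_pM2l//.
apply: (@le_trans _ _ (Num.sqrt (n%:R^-1 ^+ 2))).
  by rewrite sqrtr_sqr ger0_norm// invr_ge0 ltW.
apply: ler_wsqrtr; rewrite expr2 ler_pM2r ?invr_gt0//.
by apply: le_trans k1; rewrite invf_le1.
Qed.

Lemma ratio_le_sqrt (R : realType) (x : R) : 0 <= x <= 1 -> x <= Num.sqrt x.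
Proof.
move=> /andP[x0 x1]; rewrite -{1}(sqr_sqrtr x0) expr2 ler_piMr ?sqrtr_ge0//.
by rewrite -sqrtr1 ler_wsqrtr.
Qed.

Theorem theorem2p3 (R : realType) (eta : R) (heta : 0 < eta < 1) :
  exists C : R, forall (k n : nat), (1 <= k)%N -> (k <= n)%N ->
    forall M : 'M[R]_n, blockmodel k M ->
    forall (d : measure_display) (T : measurableType d) (P : probability T R)
      (X : 'I_n -> 'I_n -> {RV P >-> R}), adjacency_RVs M X ->
    forall Mhat : T -> 'M[R]_n,
      (forall w, usvt_estimate eta (\matrix_(i, j) X i j w) (Mhat w)) ->
      (MSE P Mhat M <= (C * Num.sqrt (k%:R / n%:R))%:E)%E.
Proof.
have e0 : 0 < eta by lra.
pose C1 := 2 * (2 + eta) ^+ 2 + 8 + 4 * (2 + eta) ^+ 2 / ((2 + eta) ^+ 2 - 4).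
(* [C1] covers the good event. In [8 * 29], 4 bounds a squared entry error, 2 counts the signs in
   the expected excess, and 29 comes from [geometric_le_sqrt]. *)
exists (C1 + 8 * 29) => k n k0 kn M blockM d T P X adjX Mhat usvtM.
have n0 : (0 < n)%N := leq_trans k0 kn.
have n0' : 0 < n%:R :> R by rewrite ltr0n.
have C10 : 0 <= C1.
  have g0 : 0 < (2 + eta) ^+ 2 - 4 by nra.
  have h : 0 <= 4 * (2 + eta) ^+ 2 / ((2 + eta) ^+ 2 - 4).
    by apply: divr_ge0; [rewrite mulr_ge0 ?sqr_ge0|exact: ltW].
  by have := sqr_ge0 (2 + eta); rewrite /C1; lra.
have [_ M01 _] := blockM.
have [Xs X01 _ _] := adjX.
pose Z w := \matrix_(i, j) X i j w - M.
pose r : R := k%:R / n%:R.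
(* An integrable majorant of the error: the first term suffices when the excess is below 1, the
   second when it is at least 1. *)
pose g w := C1 * r + 4 * lattice_excess (Z w).
have fg w : (n%:R ^+ 2)^-1 * \sum_i \sum_j (Mhat w i j - M i j) ^+ 2 <= g w.
  have -> : \sum_i \sum_j (Mhat w i j - M i j) ^+ 2 = fro (Mhat w - M).
    by apply: eq_bigr => i _; apply: eq_bigr => j _; rewrite !mxE.
  have r0 : 0 <= C1 * r by rewrite mulr_ge0// divr_ge0.
  have ex0 := lattice_excess_ge0 (Z w).
  rewrite mulrC ler_pdivrMr ?exprn_gt0//.
  have [ex1|ex1] := ltP (lattice_excess (Z w)) 1.
    apply: le_trans (usvt_estimate_error_le e0 n0 blockM _ _ ex1 (usvtM w)) _.
    - apply/matrixP => i j; rewrite !mxE Xs.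
      by rewrite (adjacency_mean_sym adjX).
    - move=> i; rewrite !mxE ler_norml; have := M01 i i.
      by case: (X01 i i w) => ->; lra.
    rewrite -/C1 [g w * _]mulrDl -[leLHS]addr0 lerD ?mulr_ge0//.
    by rewrite -mulrA ler_wpM2l// /r le_eqVlt; apply/orP; left; apply/eqP;
      have := gt_eqF n0' => /negbT ?; field.
  apply: (@le_trans _ _ (4 * n%:R ^+ 2)).
    have -> : 4 * n%:R ^+ 2 = \sum_(i < n) \sum_(j < n) (4 : R).
      by rewrite !sumr_const !card_ord -mulrnA -[RHS]mulr_natr natrM expr2.
    apply: ler_sum => i _; apply: ler_sum => j _.
    have [s [U [V [_ ->]]]] := usvtM w.
    by rewrite !mxE; apply: trunc1_sqr_le4.
  by rewrite ler_wpM2r ?exprn_ge0// /g; lra.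
have f0 w : 0 <= (n%:R ^+ 2)^-1 * \sum_i \sum_j (Mhat w i j - M i j) ^+ 2.
  rewrite mulr_ge0 ?invr_ge0 ?exprn_ge0//.
  by apply: sumr_ge0 => i _; apply: sumr_ge0 => j _; exact: sqr_ge0.
apply: le_trans (ge0_expectation_mono P f0 fg) _.
have iE := integrable_lattice_excess adjX.
rewrite unlock; under eq_integral do rewrite EFinD EFinM.
rewrite integralD//=; last 2 first.
- exact: finite_measure_integrable_cst.
- by under eq_fun do rewrite EFinM; apply: integrableZl.
under [X in (_ + X)%E]eq_integral do rewrite EFinM.
rewrite integralZl// integral_cst//= probability_setT mule1.
have := expectation_lattice_excess_le adjX M01; rewrite unlock => Ele.
apply: (@le_trans _ _ ((C1 * r)%:E + 4%:E * (2 * (29 / 30) ^+ n)%:E)%E).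
  by rewrite leeD2l// lee_wpmul2l.
rewrite -EFinM -EFinD lee_fin [(C1 + _) * _]mulrDl lerD//.
  rewrite ler_wpM2l// ratio_le_sqrt//; apply/andP; split.
    by rewrite divr_ge0.
  by rewrite ler_pdivrMr// mul1r ler_nat.
have := geometric_le_sqrt R k0 n0; lra.
Qed.
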